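(* Let $M$ be a nonsingular right $R$-module with injective hull $E(M)$. Let $\overline{M}$ denote the intersection of all ADS submodules of $E(M)$ containing $M$. Suppose that for every $e=e^2\in \operatorname{End}_R(\overline{M})$ and every ADS submodule $N$ of $E(M)$ containing $M$ we have $e^*(N)\subseteq N$, where $e^*$ is the unique extension of $e$ to an endomorphism of $E(M)$. Then $\overline{M}$ is, up to isomorphism, the unique ADS hull of $M$; that is, $\overline{M}$ is an ADS hull of $M$ and every ADS hull of $M$ is isomorphic to $\overline{M}$.
   Context: All rings are associative with identity and all modules are unital right modules. For a submodule $S$ of a module $X$, a complement of $S$ in $X$ is a submodule of $X$ maximal with respect to having zero intersection with $S$. A module $X$ is called ADS if for every decomposition $X=S\oplus T$ and every complement $T'$ of $S$ in $X$ we have $X=S\oplus T'$. A module $M$ is nonsingular if no nonzero element of $M$ is annihilated by an essential right ideal of $R$. Since $M\subseteq\overline{M}\subseteq E(M)$, $E(M)$ is also an injective hull of the nonsingular module $\overline{M}$, and every endomorphism of $\overline{M}$ extends uniquely to $E(M)$ (extensions of idempotents being idempotent). An ADS hull of $M$ is a smallest ADS essential extension of $M$: an ADS module $H$ together with an essential monomorphism $j:M\to H$ such that for every ADS module $N$ and every essential monomorphism $g:M\to N$ there is a monomorphism $h:H\to N$ with $h\circ j=g$. *)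

(* Defs.v *)
From HB Require Import structures.
From mathcomp Require Import all_boot all_order all_algebra.
From mathcomp Require Import boolp classical_sets.

Set Implicit Arguments.
Unset Strict Implicit.
Unset Printing Implicit Defensive.

Import GRing.Theory.
Local Open Scope ring_scope.

(* [lmodType] only provides left modules; a right R-module is a left module
   over the converse ring R^c.  With x . r written [r *: x], the law
   (x . r) . s = x . (r * s) is [scalerA] over R^c. *)
Notation rmodType R := (lmodType R^c).

Section Submodules.
Variables (A : pzRingType) (X : lmodType A).
Implicit Types S T C D : submodClosed X.

Record submod (N : {pred X}) := Submod { submod_val : X; _ : submod_val \in N }.
HB.instance Definition _ N := [isSub for @submod_val N].
HB.instance Definition _ N := [Choice of submod N by <:].
HB.instance Definition _ (N : submodClosed X) :=
  [SubChoice_isSubLmodule of submod N by <:].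

Definition trivial_meet S T : Prop := forall x, x \in S -> x \in T -> x = 0.

Definition direct_decomposition S T : Prop :=
  trivial_meet S T /\ forall x, exists s t, [/\ s \in S, t \in T & x = s + t].

Definition is_complement S C : Prop :=
  trivial_meet S C /\
  forall D, {subset C <= D} -> trivial_meet S D -> {subset D <= C}.

Definition essential (P : set X) : Prop :=
  forall K : submodClosed X,
    (forall x, x \in K -> P x -> x = 0) -> forall x, x \in K -> x = 0.

End Submodules.

Definition ADS (A : pzRingType) (X : lmodType A) : Prop :=
  forall S T : submodClosed X, direct_decomposition S T ->
  forall T' : submodClosed X, is_complement S T' -> direct_decomposition S T'.

Definition essential_mono (A : pzRingType) (X Y : lmodType A)
    (f : {linear X -> Y}) : Prop :=
  injective f /\ essential (range f).

Definition injective_module (A : pzRingType) (E : lmodType A) : Prop :=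
  forall (X Y : lmodType A) (f : {linear X -> Y}) (g : {linear X -> E}),
    injective f -> exists h : {linear Y -> E}, forall x, h (f x) = g x.

Definition injective_hull (A : pzRingType) (M E : lmodType A)
    (i : {linear M -> E}) : Prop :=
  injective_module E /\ essential_mono i.

(* Multiplication in (R^c)^o is [r *: x = x * r] in R, so the submodules of
   (R^c)^o are exactly the right ideals of R. *)
Definition nonsingular (R : pzRingType) (M : rmodType R) : Prop :=
  forall x : M,
    (exists I : submodClosed (R^c)^o,
       essential [set` I] /\ forall r : R^c, r \in I -> r *: x = 0) ->
    x = 0.

Definition is_ADS_hull (A : pzRingType) (M H : lmodType A)
    (j : {linear M -> H}) : Prop :=
  [/\ ADS H, essential_mono j &
      forall (N : lmodType A) (g : {linear M -> N}),
        ADS N -> essential_mono g ->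
        exists h : {linear H -> N}, injective h /\ forall m, h (j m) = g m].

Definition isomorphic (A : pzRingType) (X Y : lmodType A) : Prop :=
  exists f : {linear X -> Y}, bijective f.

Section ADSIntersection.
Variables (A : pzRingType) (M E : lmodType A) (i : {linear M -> E}).

Definition ADS_over (N : submodClosed E) : Prop :=
  ADS (submod N) /\ forall m, i m \in N.

Definition ADS_meet : {pred E} :=
  [pred x | `[< forall N : submodClosed E, ADS_over N -> x \in N >]].

Fact ADS_meet_closed : submod_closed ADS_meet.
Proof.
split=> [|a x y /asboolP xP /asboolP yP]; apply/asboolP => N hN.
  exact: rpred0.
by apply: rpredD; [apply: rpredZ; exact: xP | exact: yP].
Qed.
HB.instance Definition _ := GRing.isSubmodClosed.Build A E ADS_meet
  (GRing.submod_closed_semi ADS_meet_closed).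

Definition Mbar : lmodType A := submod ADS_meet.

Fact mem_ADS_meet m : i m \in ADS_meet.
Proof. by apply/asboolP => N [_]; apply. Qed.

Definition to_Mbar (m : M) : Mbar := Submod (mem_ADS_meet m).

Fact to_Mbar_is_linear : linear to_Mbar.
Proof. by move=> a x y; apply/val_inj; rewrite /= linearP. Qed.
HB.instance Definition _ := GRing.isSemilinear.Build A M Mbar _ to_Mbar
  (GRing.semilinear_linear to_Mbar_is_linear).

Definition extends_to_hull (e : {linear Mbar -> Mbar}) (e' : {linear E -> E}) :
    Prop :=
  forall x : Mbar, e' (submod_val x) = submod_val (e x).

End ADSIntersection.

(* Main.v *)
Require Import Defs.
From HB Require Import structures.
From mathcomp Require Import all_boot all_order all_algebra.
From mathcomp Require Import boolp classical_sets.

Set Implicit Arguments.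
Unset Strict Implicit.
Unset Printing Implicit Defensive.

Import GRing.Theory.
Local Open Scope ring_scope.

(** Write B for the intersection of the ADS submodules N of E containing M.

    B is ADS.  Let B = S + T be a direct sum and C a complement of S in B.
    Injectivity of E gives an endomorphism p of E that is the identity on S and
    0 on T; it extends the projection of B onto S, and it is idempotent because
    E is nonsingular and B is essential in E.  By hypothesis p maps every N into
    itself, so N splits as the fixed points of p plus the kernel of p, and the
    fixed points of p in B are exactly S.  By Zorn, C grows to a complement C'
    of the fixed points in N, and since N is ADS each x in B is s + c with s
    fixed by p and c in C' ([complement_lift]).  The point is that c does not
    depend on N: on the essential submodule S + C all these decompositions agree
    with the obvious one, and two elements of a nonsingular module with the same
    multiples by an essential right ideal are equal
    ([nonsingular_essential_eq0]).  Hence c lies in every N, i.e. in B, whence c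
    is in C and s is in S ([ADS_within_meet]).

    The whole module E is ADS ([ADS_within_full]), so the family of the N is not
    empty and one of them is available to start the comparison.

    B is smallest.  An ADS module N that is an essential extension of M embeds
    in E over M by injectivity, with an ADS image; so B lies in the image
    ([ADS_meet_sub_image]) and B embeds in N.  If H is another ADS hull, its
    minimality embeds H in B over M; the image in E is an ADS submodule
    containing M, so it contains B, and H is isomorphic to B. *)

(** * Submodules *)

Section SubmoduleConstructions.
Variables (A : pzRingType) (X : lmodType A).

Lemma submodule_comprehension (P : X -> Prop) :
  P 0 -> (forall a x y, P x -> P y -> P (a *: x + y)) ->
  exists S : submodClosed X, forall x, x \in S <-> P x.
Proof.
move=> P0 Plin.
pose p : {pred X} := [pred x : X | `[< P x >]].
have p_closed : submod_closed p.
  split=> [|a x y /asboolP Px /asboolP Py]; apply/asboolP => //.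
  exact: Plin.
pose S : submodClosed X := HB.pack_for (submodClosed X) p
  (GRing.isSubmodClosed.Build A X p (GRing.submod_closed_semi p_closed)).
by exists S => x; split=> [/asboolP|Px] //; apply/asboolP.
Qed.

Lemma submodB (S : submodClosed X) x y :
  x \in S -> y \in S -> x - y \in S.
Proof. by move=> xS yS; rewrite -scaleN1r rpredD ?rpredZ. Qed.

Definition sum_submod (S T : submodClosed X) : {pred X} :=
  [pred x | `[< exists s t, [/\ s \in S, t \in T & x = s + t] >]].

Lemma sum_submodP (S T : submodClosed X) x :
  reflect (exists s t, [/\ s \in S, t \in T & x = s + t])
          (x \in sum_submod S T).
Proof. exact: asboolP. Qed.

Fact sum_submod_closed S T : submod_closed (sum_submod S T).
Proof.
split=> [|a _ _ /sum_submodP[s [t [sS tT ->]]]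
              /sum_submodP[s' [t' [sS' tT' ->]]]].
  by apply/sum_submodP; exists 0, 0; rewrite !rpred0 addr0.
apply/sum_submodP; exists (a *: s + s'), (a *: t + t').
by split; rewrite ?rpredD ?rpredZ // scalerDr addrACA.
Qed.

HB.instance Definition _ S T := GRing.isSubmodClosed.Build A X (sum_submod S T)
  (GRing.submod_closed_semi (sum_submod_closed S T)).

Lemma sum_submodl (S T : submodClosed X) : {subset S <= sum_submod S T}.
Proof.
by move=> s sS; apply/sum_submodP; exists s, 0; rewrite rpred0 addr0.
Qed.

Lemma sum_submodr (S T : submodClosed X) : {subset T <= sum_submod S T}.
Proof.
by move=> t tT; apply/sum_submodP; exists 0, t; rewrite rpred0 add0r.
Qed.

Lemma trivial_meet_sum_inj (S T : submodClosed X) s t s' t' :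
  trivial_meet S T -> s \in S -> t \in T -> s' \in S -> t' \in T ->
  s + t = s' + t' -> s = s' /\ t = t'.
Proof.
move=> meet sS tT sS' tT' eq_st.
have eq_diff : s - s' = t' - t.
  by apply/eqP; rewrite subr_eq addrAC eq_sym subr_eq eq_st addrC.
have eq_s : s = s'.
  by apply/subr0_eq/meet; [rewrite submodB | rewrite eq_diff submodB].
by split=> //; move: eq_st; rewrite eq_s => /addrI.
Qed.

End SubmoduleConstructions.
Arguments submodule_comprehension {A X} P.

(** * Complements inside a submodule *)

Section RelativeComplement.
Variables (A : pzRingType) (X : lmodType A).
Implicit Types N S T C D : submodClosed X.

Definition relative_complement N S C : Prop :=
  [/\ {subset C <= N}, trivial_meet S C &
      forall D, {subset D <= N} -> {subset C <= D} -> trivial_meet S D ->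
        {subset D <= C}].

(** The ADS condition on N, stated with submodules of the ambient module: the
    ADS submodules of E can then be compared without changing the carrier. *)
Definition ADS_within N : Prop :=
  forall S T C, {subset S <= N} -> {subset T <= N} -> trivial_meet S T ->
  {subset N <= sum_submod S T} -> relative_complement N S C ->
  {subset N <= sum_submod S C}.

Lemma relative_complement_exists N S C0 :
  {subset C0 <= N} -> trivial_meet S C0 ->
  exists C, relative_complement N S C /\ {subset C0 <= C}.
Proof.
move=> C0N SC0.
pose good C := [/\ {subset C0 <= C}, {subset C <= N} & trivial_meet S C].
have good0 : good C0 by split.
pose T := {C : submodClosed X | good C}.
pose le (C D : T) := `[< {subset sval C <= sval D} >].
have le_refl (C : T) : le C C by apply/asboolP.
have le_trans (C D F : T) : le C D -> le D F -> le C F.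
  by move=> /asboolP CD /asboolP DF; apply/asboolP => x /CD /DF.
have chain_ub (F : set T) : total_on F (fun C D : T => le C D) ->
    exists U : T, forall C : T, F C -> le C U.
  move=> F_total.
  have [[C1 FC1]|F_empty] := pselect (exists C : T, F C); last first.
    by exists (exist _ C0 good0) => C FC; case: F_empty; exists C.
  have [U UE] : exists U : submodClosed X,
      forall x, x \in U <-> exists2 C : T, F C & x \in sval C.
    apply: submodule_comprehension; first by exists C1; rewrite ?rpred0.
    move=> a x y [C FC xC] [D FD yD].
    by have [/asboolP CD|/asboolP DC] := F_total _ _ FC FD;
       [exists D | exists C]; rewrite // rpredD ?rpredZ //; auto.
  have good_U : good U.
    split=> [x xC0|x /UE[C _ xC]|x xS /UE[C _ xC]].
    - by apply/UE; exists C1 => //; case: (svalP C1) => sub _ _; apply: sub.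
    - by case: (svalP C) => _ sub _; apply: sub.
    - by case: (svalP C) => _ _ meet; apply: meet.
  by exists (exist _ U good_U) => C FC; apply/asboolP => x xC; apply/UE; exists C.
have [[C [C0C CN SC]] C_max] :=
  ZL_preorder (exist _ C0 good0) le_refl le_trans chain_ub.
exists C; split=> //; split=> // D DN CD SD.
have good_D : good D by split=> // x /C0C /CD.
have le_CD : le (exist _ C (And3 C0C CN SC)) (exist _ D good_D) by apply/asboolP.
by have /asboolP := C_max _ le_CD.
Qed.

(** Anything missing S + C could be added to C without meeting S, contradicting
    maximality; this gives essentiality in N, and it passes to X because N
    contains an essential subset. *)
Lemma relative_complement_sum_essential N S C (P : set X) :
  {subset S <= N} -> relative_complement N S C -> essential P ->
  (forall x, P x -> x \in N) -> essential [set` sum_submod S C].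
Proof.
move=> SN [CN SC C_max] P_ess PN K KSC; apply: P_ess => x xK Px.
have [K' K'E] : exists K' : submodClosed X,
    forall y, y \in K' <-> y \in K /\ y \in N.
  apply: submodule_comprehension; first by rewrite !rpred0.
  by move=> a y z [yK yN] [zK zN]; rewrite !rpredD ?rpredZ.
have K'SC y : y \in K' -> y \in sum_submod S C -> y = 0.
  by move=> /K'E[yK _] ySC; apply: KSC.
have x_K' : x \in K' by apply/K'E; split=> //; apply: PN.
apply: (K'SC _ x_K'); apply: sum_submodr.
apply: (C_max (sum_submod C K')).
- move=> _ /sum_submodP[c [k [cC /K'E[_ kN] ->]]].
  by rewrite rpredD // CN.
- exact: sum_submodl.
- move=> s sS /sum_submodP[c [k [cC kK' def_s]]].
  have k0 : k = 0.
    apply: K'SC => //; have -> : k = (c + k) - c by rewrite addrC addKr.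
    rewrite submodB //; first by apply: sum_submodl; rewrite -def_s.
    exact: sum_submodr.
  by apply: SC => //; rewrite def_s k0 addr0.
- exact: sum_submodr.
Qed.

End RelativeComplement.

(** Being ADS is invariant under isomorphism, and does not depend on whether a
    submodule is regarded as a type or as a subset. *)
Lemma ADS_image (A : pzRingType) (Y X : lmodType A) (f : {linear Y -> X})
    (N : submodClosed X) :
  injective f -> (forall x, x \in N <-> exists y, f y = x) ->
  ADS Y <-> ADS_within N.
Proof.
move=> f_inj NE.
have fN y : f y \in N by apply/NE; exists y.
have f0 y : f y = 0 -> y = 0 by move=> fy0; apply: f_inj; rewrite fy0 linear0.
have preim (S : submodClosed X) : exists S' : submodClosed Y,
    forall y, y \in S' <-> f y \in S.
  apply: submodule_comprehension; first by rewrite linear0 rpred0.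
  by move=> a y z yS zS; rewrite linearP rpredD ?rpredZ.
have image (S : submodClosed Y) : exists S' : submodClosed X,
    (forall y, f y \in S' <-> y \in S) /\
    (forall x, x \in S' -> exists2 y, y \in S & x = f y).
  have [S' S'E] : exists S' : submodClosed X,
      forall x, x \in S' <-> exists2 y, y \in S & x = f y.
    apply: submodule_comprehension; first by exists 0; rewrite ?rpred0 ?linear0.
    move=> a _ _ [y yS ->] [z zS ->].
    by exists (a *: y + z); rewrite ?linearP ?rpredD ?rpredZ.
  exists S'; split=> [y|x /S'E]; last by []. split=> [/S'E[z zS /f_inj -> //]|yS].
  by apply/S'E; exists y.
split=> [Y_ADS S T C SN TN ST NST [CN SC C_max]|N_ADS S T [ST YST] C [SC C_max]].
- have [S' S'E] := preim S; have [T' T'E] := preim T.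
  have [C' C'E] := preim C.
  have [||_ YSC] := Y_ADS S' T' _ C' _.
  + split=> [y /S'E yS /T'E yT|y]; first by apply/f0/ST.
    have /sum_submodP[s [t [sS tT def_y]]] := NST _ (fN y).
    have /NE[a def_s] := SN _ sS; have /NE[b def_t] := TN _ tT.
    exists a, b; split; first by apply/S'E; rewrite def_s.
      by apply/T'E; rewrite def_t.
    by apply: f_inj; rewrite linearD def_s def_t.
  + split=> [y /S'E yS /C'E yC|D C'D S'D d dD]; first by apply/f0/SC.
    have [D' [D'E D'_im]] := image D.
    apply/C'E; apply: (C_max D'); last exact/D'E.
    * by move=> x /D'_im[y _ ->].
    * move=> x xC; have /NE[y def_x] := CN _ xC; rewrite -def_x.
      by apply/D'E/C'D/C'E; rewrite def_x.
    * move=> x xS /D'_im[y yD def_x]; rewrite def_x (S'D y) ?linear0 //.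
      by apply/S'E; rewrite -def_x.
  + move=> x /NE[y <-]; have [s [c [sS cC ->]]] := YSC y.
    apply/sum_submodP; exists (f s), (f c).
    by split; [apply/S'E | apply/C'E | rewrite linearD].
- have [S' [S'E S'_im]] := image S; have [T' [T'E T'_im]] := image T.
  have [C' [C'E C'_im]] := image C.
  split=> // y.
  have NSC : {subset N <= sum_submod S' C'}.
    apply: (N_ADS S' T' C').
    + by move=> _ /S'_im[z _ ->].
    + by move=> _ /T'_im[z _ ->].
    + move=> _ /S'_im[z zS ->] /T'E zT.
      by rewrite (ST z) ?linear0.
    + move=> _ /NE[z <-]; have [s [t [sS tT ->]]] := YST z.
      apply/sum_submodP; exists (f s), (f t).
      by split; [apply/S'E | apply/T'E | rewrite linearD].
    + split=> [_ /C'_im[z _ ->] //||D DN C'D S'D _d /[dup] /DN /NE[d <-] dD].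
        move=> _ /S'_im[z zS ->] /C'E zC.
        by rewrite (SC z) ?linear0.
      have [D' D'E] := preim D.
      apply/C'E; apply: (C_max D'); last exact/D'E.
        by move=> z zC; apply/D'E/C'D/C'E.
      by move=> z zS /D'E zD; apply/f0/S'D => //; apply/S'E.
  have /sum_submodP[_ [_ [/S'_im[s sS ->] /C'_im[c cC ->]]]] := NSC _ (fN y).
  by rewrite -linearD => /f_inj def_y; exists s, c.
Qed.

Lemma ADS_submodP (A : pzRingType) (X : lmodType A) (N : submodClosed X) :
  ADS (submod N) <-> ADS_within N.
Proof.
apply: (@ADS_image _ _ _ \val); first exact: val_inj.
by move=> x; split=> [xN|[y <-]]; [exists (Submod xN) | exact: valP].
Qed.

(** * Essential submodules and nonsingular modules *)

Lemma essentialS (A : pzRingType) (X : lmodType A) (P Q : set X) :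
  (forall x, P x -> Q x) -> essential P -> essential Q.
Proof. by move=> PQ P_ess K KQ; apply: P_ess => x xK /PQ; apply: KQ. Qed.

Lemma essential_mono_cancel (A : pzRingType) (X Y Z : lmodType A)
    (f : {linear X -> Y}) (h : {linear Y -> Z}) :
  essential_mono f -> injective (h \o f) -> injective h.
Proof.
move=> [_ f_ess] hf_inj x y eq_h; apply/subr0_eq.
have [K KE] : exists K : submodClosed Y, forall z, z \in K <-> h z = 0.
  apply: submodule_comprehension; first by rewrite linear0.
  by move=> a u v hu hv; rewrite linearP hu hv scaler0 addr0.
apply: (f_ess K); last by apply/KE; rewrite linearB eq_h subrr.
move=> z /KE hz0 [m _ def_z]; rewrite -def_z in hz0 *.
by rewrite (hf_inj m 0) ?linear0 //= hz0 !linear0.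
Qed.

Section Nonsingular.
Variable R : pzRingType.

Lemma essential_colon (Y : rmodType R) (K : submodClosed Y) (y : Y) :
  essential [set` K] ->
  exists I : submodClosed (R^c)^o,
    essential [set` I] /\ forall r : R^c, r \in I <-> r *: y \in K.
Proof.
move=> K_ess.
have [I IE] : exists I : submodClosed (R^c)^o,
    forall r, r \in I <-> (r : R^c) *: y \in K.
  apply: submodule_comprehension; first by rewrite scale0r rpred0.
  move=> a r s rK sK; rewrite scalerDl rpredD //.
  by rewrite -[(a *: r) *: y]/(((a : R^c) * r) *: y) -scalerA rpredZ.
exists I; split=> // J JI.
have [Jy JyE] : exists Jy : submodClosed Y,
    forall z, z \in Jy <-> exists2 r : R^c, r \in J & z = r *: y.
  apply: submodule_comprehension; first by exists 0;
    [exact: (rpred0 J) | rewrite scale0r].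
  move=> a _ _ [r rJ ->] [s sJ ->].
  exists (a * r + s); last by rewrite scalerDl scalerA.
  exact: (@rpredD _ J _ _ (@rpredZ _ _ J a r rJ) sJ).
have Jy0 z : z \in Jy -> z = 0.
  apply: K_ess => {}z /JyE[r rJ ->] /= ryK.
  by rewrite (JI r) ?scale0r //=; apply/IE.
move=> r rJ; apply: JI => //=; apply/IE.
by rewrite (Jy0 (r *: y)) ?rpred0 //; apply/JyE; exists r.
Qed.

(** The right ideal of the r with y r in K is essential. *)
Lemma nonsingular_essential_eq0 (X Y : rmodType R) (K : submodClosed Y)
    (y : Y) (d : X) :
  nonsingular X -> essential [set` K] ->
  (forall r : R^c, r *: y \in K -> r *: d = 0) -> d = 0.
Proof.
move=> X_ns K_ess Kd; apply: X_ns.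
have [I [I_ess IE]] := essential_colon y K_ess.
by exists I; split=> // r /IE; apply: Kd.
Qed.

Lemma nonsingular_essential_extension (M E : rmodType R)
    (i : {linear M -> E}) :
  nonsingular M -> essential_mono i -> nonsingular E.
Proof.
move=> M_ns [i_inj i_ess] x [L [L_ess Lx0]].
have [K KE] : exists K : submodClosed E,
    forall y, y \in K <-> exists r : R^c, y = r *: x.
  apply: submodule_comprehension; first by exists 0; rewrite scale0r.
  by move=> a _ _ [r ->] [s ->]; exists (a * r + s); rewrite scalerDl scalerA.
apply: (i_ess K); last by apply/KE; exists 1; rewrite scale1r.
move=> _ /KE[r ->] [m _ def_m]; rewrite -def_m.
suff -> : m = 0 by rewrite linear0.
apply: (@nonsingular_essential_eq0 _ (R^c)^o L r) => // q qrL.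
apply: i_inj; rewrite linearZ linear0 /= def_m scalerA.
exact: Lx0.
Qed.

End Nonsingular.

(** * Splittings inside an injective module *)

(** Extend the first projection along the embedding (s, t) |-> s + t of the
    external direct sum. *)
Lemma injective_projection (A : pzRingType) (E : lmodType A)
    (S T : submodClosed E) :
  injective_module E -> trivial_meet S T ->
  exists p : {linear E -> E},
    (forall s, s \in S -> p s = s) /\ (forall t, t \in T -> p t = 0).
Proof.
move=> E_inj ST.
pose add (z : submod S * submod T) : E := \val z.1 + \val z.2.
have add_linear : linear add.
  by move=> a z w; rewrite /add /= scalerDr addrACA.
pose addL : {linear (submod S * submod T)%type -> E} :=
  HB.pack add (GRing.isLinear.Build A _ _ _ add add_linear).
pose fst_val (z : submod S * submod T) : E := \val z.1.
have fst_linear : linear fst_val by [].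
pose fstL : {linear (submod S * submod T)%type -> E} :=
  HB.pack fst_val (GRing.isLinear.Build A _ _ _ fst_val fst_linear).
have add_inj : injective addL.
  move=> [s t] [s' t'] /(@trivial_meet_sum_inj _ _ S T) [] //; try exact: valP.
  by move=> /= /val_inj -> /val_inj ->.
have [p pE] := E_inj _ _ addL fstL add_inj.
exists p; split=> [s sS|t tT].
  by have := pE (Submod sS, 0); rewrite /= /add /fst_val /= addr0.
by have := pE (0, Submod tT); rewrite /= /add /fst_val /= add0r.
Qed.

(** A complement C of a summand S has a projection p that is the identity on C
    and kills S.  Nonsingularity makes p idempotent with image C by maximality,
    and its kernel cannot exceed S, because S + C is essential and S is a
    summand. *)
Lemma ADS_within_full (R : pzRingType) (E : rmodType R) (N : submodClosed E) :
  nonsingular E -> injective_module E -> (forall x, x \in N) ->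
  ADS_within N.
Proof.
move=> E_ns E_inj N_full S T C SN TN ST NST SC_compl x _.
have [_ SC C_max] := SC_compl.
have CS : trivial_meet C S by move=> y yC yS; apply: SC.
have [p [pC pS]] := injective_projection E_inj CS.
have SC_ess : essential [set` sum_submod S C].
  apply: (@relative_complement_sum_essential _ _ N S C setT) => // K K0 y yK.
  exact: K0.
have p_idem y : p (p y) = p y.
  apply/subr0_eq/(@nonsingular_essential_eq0 _ E E (sum_submod S C) y) => //.
  move=> r /sum_submodP[s [c [sS cC def_ry]]].
  rewrite scalerBr -!linearZ /= def_ry linearD (pS s) // (pC c) // add0r.
  by rewrite pC // subrr.
have pE_C y : p y \in C.
  have [D DE] : exists D : submodClosed E, forall z, z \in D <-> p z = z.
    apply: submodule_comprehension; first by rewrite linear0.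
    by move=> a u v pu pv; rewrite linearP pu pv.
  apply: (C_max D); rewrite ?DE //.
    by move=> c cC; apply/DE/pC.
  by move=> s sS /DE <-; rewrite pS.
have /sum_submodP[s [t [sS tT def_st]]] := NST _ (N_full (x - p x)).
have pt0 : p t = 0.
  have : p (x - p x) = 0 by rewrite linearB /= p_idem subrr.
  by rewrite def_st linearD (pS s) // add0r.
have t0 : t = 0.
  apply: (@nonsingular_essential_eq0 _ E E (sum_submod S C) t) => //.
  move=> r /sum_submodP[s' [c [s'S cC def_rt]]].
  have c0 : c = 0.
    have : p (r *: t) = 0 by rewrite linearZ /= pt0 scaler0.
    by rewrite def_rt linearD (pS s') // (pC c) // add0r.
  by apply: ST; [rewrite def_rt c0 addr0 | rewrite rpredZ].
apply/sum_submodP; exists s, (p x); split=> //.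
by rewrite -[s]addr0 -t0 -def_st subrK.
Qed.

(** S is the set of fixed points of p in B, so replacing S by the fixed points
    of p in N does not change what the summand does inside B.  The complement
    C' is chosen with C' meeting B in C. *)
Lemma complement_lift (A : pzRingType) (E : lmodType A)
    (B N S C : submodClosed E) (p : {linear E -> E}) :
  (forall x, p (p x) = p x) -> (forall x, x \in N -> p x \in N) ->
  {subset B <= N} -> (forall x, x \in B -> p x = x -> x \in S) ->
  (forall s, s \in S -> p s = s) ->
  relative_complement B S C -> ADS_within N ->
  exists C' : submodClosed E,
    [/\ {subset C <= C'}, {subset C' <= N},
        forall x, x \in C' -> p x = x -> x = 0,
        forall x, x \in C' -> x \in B -> x \in C &
        forall x, x \in N -> exists s c, [/\ p s = s, c \in C' & x = s + c]].
Proof.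
move=> p_idem pN BN fixB_S pS [CB SC C_max] N_ADS.
have [F FE] : exists F : submodClosed E, forall x, x \in F <-> x \in N /\ p x = x.
  apply: submodule_comprehension; first by rewrite linear0 rpred0.
  by move=> a u v [uN pu] [vN pv]; rewrite linearP pu pv rpredD ?rpredZ.
have [G GE] : exists G : submodClosed E, forall x, x \in G <-> x \in N /\ p x = 0.
  apply: submodule_comprehension; first by rewrite linear0 rpred0.
  move=> a u v [uN pu] [vN pv].
  by rewrite linearP pu pv scaler0 addr0 rpredD ?rpredZ.
have FC : trivial_meet F C.
  by move=> x /FE[_ px] xC; apply: SC => //; apply: fixB_S => //; apply: CB.
have [|C' [[C'N FC' C'_max] CC']] := @relative_complement_exists _ _ N F C _ FC.
  by move=> x /CB /BN.
have N_FC' : {subset N <= sum_submod F C'}.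
  apply: (N_ADS F G C') => //.
  - by move=> x /FE[].
  - by move=> x /GE[].
  - by move=> x /FE[_ px] /GE[_]; rewrite px.
  - move=> x xN; apply/sum_submodP; exists (p x), (x - p x); split.
    + by apply/FE; split; [apply: pN | apply: p_idem].
    + by apply/GE; rewrite submodB ?pN // linearB /= p_idem subrr.
    + by rewrite addrC subrK.
exists C'; split=> //.
- by move=> x xC' px; apply: FC' => //; apply/FE; split=> //; apply: C'N.
- move=> x xC' xB.
  have [D DE] : exists D : submodClosed E,
      forall y, y \in D <-> y \in C' /\ y \in B.
    apply: submodule_comprehension; first by rewrite !rpred0.
    by move=> a u v [uC uB] [vC vB]; rewrite !rpredD ?rpredZ.
  apply: (C_max D); last exact/DE.
  + by move=> y /DE[].
  + by move=> y yC; apply/DE; split; [apply: CC' | apply: CB].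
  + move=> y yS /DE[yC' yB]; apply: FC' => //.
    by apply/FE; split; [apply: BN | apply: pS].
- move=> x /N_FC'/sum_submodP[s [c [/FE[_ ps] cC' def_x]]].
  by exists s, c.
Qed.

(** * The intersection of the ADS submodules over M *)

Section ADSMeet.
Variables (R : pzRingType) (M E : rmodType R) (i : {linear M -> E}).
Hypothesis M_nonsingular : nonsingular M.
Hypothesis E_hull : injective_hull i.

Let E_injective : injective_module E. Proof. by case: E_hull. Qed.
Let i_mono : essential_mono i. Proof. by case: E_hull. Qed.
Let E_nonsingular : nonsingular E.
Proof. exact: nonsingular_essential_extension M_nonsingular i_mono. Qed.
Local Notation B := (ADS_meet i : submodClosed E).

Lemma ADS_meet_essential : essential [set` ADS_meet i].
Proof.
by apply: essentialS (proj2 i_mono) => _ [m _ <-] /=; apply: mem_ADS_meet.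
Qed.

Lemma ADS_meet_sub (N : submodClosed E) :
  ADS_over i N -> {subset ADS_meet i <= N}.
Proof. by move=> N_over x /asboolP; apply. Qed.

Lemma ADS_within_meet :
  (forall e : {linear Mbar i -> Mbar i},
     (forall x, e (e x) = e x) ->
     forall e' : {linear E -> E}, extends_to_hull e e' ->
     forall N : submodClosed E, ADS_over i N ->
     forall x, x \in N -> e' x \in N) ->
  ADS_within B.
Proof.
move=> stable S T C SB TB ST BST SC_compl x xB.
have [CB _ _] := SC_compl.
have [p [pS pT]] := injective_projection E_injective ST.
have pB_S y : y \in B -> p y \in S.
  by move=> /BST/sum_submodP[s [t [sS tT ->]]]; rewrite linearD pS // pT // addr0.
have p_idem y : p (p y) = p y.
  apply/subr0_eq.
  apply: (@nonsingular_essential_eq0 _ E E B y) => //.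
    exact: ADS_meet_essential.
  by move=> r /pB_S; rewrite scalerBr -!linearZ /= => /pS ->; rewrite subrr.
have pB (y : Mbar i) : p (\val y) \in ADS_meet i.
  by apply/SB/pB_S; apply: valP.
pose e (y : Mbar i) : Mbar i := Submod (pB y).
have e_linear : linear e.
  by move=> a y z; apply: val_inj; rewrite /= linearP.
pose eL : {linear Mbar i -> Mbar i} :=
  HB.pack e (GRing.isLinear.Build _ _ _ _ e e_linear).
have pN N : ADS_over i N -> forall y, y \in N -> p y \in N.
  apply: (stable eL) => // y; apply: val_inj => /=; exact: p_idem.
have fixB_S y : y \in B -> p y = y -> y \in S by move=> /pB_S + py; rewrite py.
have lift N : ADS_over i N -> _ := fun N_over => complement_lift
  p_idem (pN N N_over) (ADS_meet_sub N_over) fixB_S pS SC_compl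
  (proj1 (ADS_submodP N) (proj1 N_over)).
have [W WE] : exists W : submodClosed E, forall y, y \in W <-> True.
  exact: submodule_comprehension.
have W_over : ADS_over i W.
  split=> [|m]; last exact/WE.
  by apply/ADS_submodP/ADS_within_full => // y; apply/WE.
have [C0 [CC0 _ fixC0 C0B_C W_C0]] := lift _ W_over.
have [|s0 [c0 [ps0 c0C0 def_x]]] := W_C0 x; first exact/WE.
have SC_ess : essential [set` sum_submod S C].
  apply: (@relative_complement_sum_essential _ _ B S C [set` ADS_meet i]) => //.
  exact: ADS_meet_essential.
(* On S + C every lifted decomposition is the given one. *)
have comp_unique (C' : submodClosed E) s c (r : R^c) s1 c1 :
    {subset C <= C'} -> (forall y, y \in C' -> p y = y -> y = 0) ->
    p s = s -> c \in C' -> x = s + c ->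
    s1 \in S -> c1 \in C -> r *: x = s1 + c1 -> r *: c = c1.
  move=> CC' fixC' ps cC' def_sc s1S c1C def_rx.
  apply/subr0_eq/fixC'; first by rewrite submodB ?rpredZ // CC'.
  have -> : r *: c - c1 = s1 - r *: s.
    apply/eqP; rewrite subr_eq addrAC eq_sym subr_eq eq_sym -def_rx def_sc.
    by rewrite scalerDr addrC.
  by rewrite linearB linearZ /= ps (pS s1).
have c0B : c0 \in B.
  apply/asboolP => N N_over.
  have [C' [CC' C'N fixC' _ N_C']] := lift _ N_over.
  have [s [c [ps cC' def_x']]] := N_C' x (ADS_meet_sub N_over xB).
  have -> : c0 = c; last exact: C'N.
  apply/subr0_eq/(@nonsingular_essential_eq0 _ E E (sum_submod S C) x) => //.
  move=> r /sum_submodP[s1 [c1 [s1S c1C def_rx]]].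
  by rewrite scalerBr (comp_unique C0 s0 c0 r s1 c1) //
             (comp_unique C' s c r s1 c1) // subrr.
apply/sum_submodP; exists s0, c0; split=> //; last exact: C0B_C.
by apply: fixB_S => //; have -> : s0 = x - c0; rewrite ?submodB // def_x addrK.
Qed.

Lemma ADS_meet_sub_image (H : rmodType R) (j : {linear M -> H})
    (f : {linear H -> E}) :
  ADS H -> injective f -> (forall m, f (j m) = i m) ->
  forall x, x \in ADS_meet i -> exists y, f y = x.
Proof.
move=> H_ADS f_inj fj x xB.
have [N NE] : exists N : submodClosed E, forall z, z \in N <-> exists y, f y = z.
  apply: submodule_comprehension; first by exists 0; rewrite linear0.
  by move=> a _ _ [y <-] [z <-]; exists (a *: y + z); rewrite linearP.
apply/NE; apply: ADS_meet_sub xB; split.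
  by apply/ADS_submodP/(@ADS_image _ _ _ f).
by move=> m; apply/NE; exists (j m).
Qed.

Lemma to_Mbar_essential_mono : essential_mono (to_Mbar i).
Proof.
have [i_inj i_ess] := i_mono.
split=> [m m' /(congr1 \val) /= /i_inj //|K K_meet k kK].
have [K' K'E] : exists K' : submodClosed E,
    forall x, x \in K' <-> exists2 y : Mbar i, y \in K & x = \val y.
  apply: submodule_comprehension; first by exists 0; rewrite ?rpred0 ?linear0.
  move=> a _ _ [y yK ->] [z zK ->].
  by exists (a *: y + z); rewrite ?rpredD ?rpredZ ?linearP.
apply: val_inj; rewrite linear0; apply: (i_ess K'); last by apply/K'E; exists k.
move=> _ /K'E[y yK ->] [m _ def_y].
rewrite (K_meet y) ?linear0 //; exists m => //.
exact: val_inj.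
Qed.

(** The embedding inverts, on B, an embedding of N into E over M. *)
Lemma Mbar_minimal (N : rmodType R) (g : {linear M -> N}) :
  ADS N -> essential_mono g ->
  exists h : {linear Mbar i -> N},
    injective h /\ forall m, h (to_Mbar i m) = g m.
Proof.
move=> N_ADS g_mono; have [g_inj g_ess] := g_mono.
have [f fg] := E_injective i g_inj.
have f_inj : injective f.
  apply: essential_mono_cancel g_mono _ => m m' /=.
  by rewrite !fg; apply: (proj1 i_mono).
have inv_exists (x : Mbar i) : exists y, f y = \val x.
  by apply: (@ADS_meet_sub_image _ g) => //; apply: valP.
pose h x := sval (cid (inv_exists x)).
have fh x : f (h x) = \val x by rewrite /h; case: cid.
have h_linear : linear h.
  by move=> a x y; apply: f_inj; rewrite linearP !fh linearP.
pose hL : {linear Mbar i -> N} :=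
  HB.pack h (GRing.isLinear.Build _ _ _ _ h h_linear).
exists hL; split=> [x y|m] /=.
  by move=> eq_h; apply: val_inj; rewrite -!fh eq_h.
by apply: f_inj; rewrite fh fg.
Qed.

End ADSMeet.

Theorem theorem4p4 (R : pzRingType) (M E : rmodType R) (i : {linear M -> E})
    (M_nonsingular : nonsingular M)
    (E_hull : injective_hull i)
    (stable : forall e : {linear Mbar i -> Mbar i},
       (forall x, e (e x) = e x) ->
       forall e' : {linear E -> E}, extends_to_hull e e' ->
       forall N : submodClosed E, ADS_over i N ->
       forall x, x \in N -> e' x \in N) :
  is_ADS_hull (to_Mbar i) /\
  forall (H : rmodType R) (j : {linear M -> H}),
    is_ADS_hull j -> isomorphic H (Mbar i).
Proof.
have Mbar_ADS : ADS (Mbar i) by apply/ADS_submodP/ADS_within_meet.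
have Mbar_mono := to_Mbar_essential_mono E_hull.
split; first by split=> // N g; apply: Mbar_minimal.
move=> H j [H_ADS _ H_min].
have [h [h_inj hj]] := H_min _ _ Mbar_ADS Mbar_mono.
have h_surj (x : Mbar i) : exists y, h y = x.
  have vh_inj : injective (\val \o h) by move=> y z /val_inj /h_inj.
  have vhj m : (\val \o h) (j m) = i m by rewrite /= hj.
  have [y def_x] := ADS_meet_sub_image H_ADS vh_inj vhj (valP x).
  by exists y; apply: val_inj.
exists h; exists (fun x => sval (cid (h_surj x))) => [y|x].
  by case: cid => z /= /h_inj.
by case: cid.
Qed.
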